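(* Let $\mathcal{M}$ be the free monoidal category with a family of monoidal endofunctors $\{E^i\mid i\in\mathcal{I}\}$ generated by a set of generating objects. Then the functor $G$ from $\mathcal{M}$ to the category $\mathit{Fun}$ of functions between finite ordinals is faithful; i.e. for all arrows $f,g:A\to B$ of $\mathcal{M}$, if $Gf=Gg$, then $f=g$ in $\mathcal{M}$.
   Context: A monoidal category is a category with a bifunctor $\otimes$, a unit object $I$, and natural isomorphisms with components $a_{A,B,C}:(A\otimes B)\otimes C\to A\otimes(B\otimes C)$, $l_A:I\otimes A\to A$, $r_A:A\otimes I\to A$, satisfying Mac Lane's coherence equations (pentagon and triangle). A monoidal endofunctor of a monoidal category is an endofunctor $E$ together with a natural transformation $\psi_{A,B}:EA\otimes EB\to E(A\otimes B)$ and an arrow $\psi_0:I\to EI$ (not assumed to be isomorphisms) such that (1) $Ea_{A,B,C}\circ\psi_{A\otimes B,C}\circ(\psi_{A,B}\otimes\mathbf{1}_{EC})=\psi_{A,B\otimes C}\circ(\mathbf{1}_{EA}\otimes\psi_{B,C})\circ a_{EA,EB,EC}$; (2) $El_A\circ\psi_{I,A}\circ(\psi_0\otimes\mathbf{1}_{EA})=l_{EA}$; (3) $Er_A\circ\psi_{A,I}\circ(\mathbf{1}_{EA}\otimes\psi_0)=r_{EA}$. The category $\mathcal{M}$: fix two arbitrary sets, one of generating objects (propositional letters) and one of generating functors $\{E^i\mid i\in\mathcal{I}\}$. Objects of $\mathcal{M}$ are the formulae built from the letters and the constant $I$ with the binary connective $\otimes$ and the unary connectives $E^i$. Arrows are equivalence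 classes of arrow terms built from $\mathbf{1}_A$, $a_{A,B,C}$, $l_A$, $r_A$, the inverses of $a,l,r$, and $\psi^i_{A,B}$, $\psi^i_0$ (for each $i\in\mathcal{I}$) with the operations $\circ$, $\otimes$ and $E^i$, modulo the smallest congruence for which the equations of monoidal categories hold and each $(E^i,\psi^i,\psi^i_0)$ is a monoidal endofunctor. Superscripts $i$ are omitted below. The functor $G$: $\mathit{Fun}$ has as objects the finite ordinals $n=\{0,\dots,n-1\}$ and as arrows all functions. $GA$ is the number of occurrences of the generating functors $E^i$ (for all $i$ together) in $A$, these occurrences being numbered $0,1,\dots$ from left to right. $G$ of $\mathbf{1}$, $a$, $l$, $r$ (and inverses) is an identity function; $G\psi_{A,B}:1+GA+1+GB\to 1+GA+GB$ maps $0\mapsto 0$, $1+k\mapsto 1+k$ for $k<GA$, $GA+1\mapsto 0$, and $GA+2+k\mapsto 1+GA+k$ for $k<GB$; $G\psi_0$ is the empty function from $0$ to $1$; $G(f\otimes g)$ is $Gf$ and $Gg$ placed side by side (disjoint sum); $GEf$ maps $0\mapsto 0$ and $1+k\mapsto 1+(Gf)(k)$; $G(g\circ f)=Gg\circ Gf$. *)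

(* Defs.v *)
From mathcomp Require Import all_boot.
From mathcomp Require Import zify.
Set Implicit Arguments.
Unset Strict Implicit.
Unset Printing Implicit Defensive.

(* Categories are presented with hom-setoids: an arrow of a
   quotient category is an arrow term, and equality of arrows is the
   congruence [hom_eq]. *)

Record category := Category {
  ob :> Type;
  hom : ob -> ob -> Type;
  hom_eq : forall A B, hom A B -> hom A B -> Prop;
  ident : forall A, hom A A;
  comp : forall A B C, hom B C -> hom A B -> hom A C;
  hom_eq_refl : forall A B (f : hom A B), hom_eq f f;
  hom_eq_sym : forall A B (f g : hom A B), hom_eq f g -> hom_eq g f;
  hom_eq_trans : forall A B (f g h : hom A B),
    hom_eq f g -> hom_eq g h -> hom_eq f h;
  comp_hom_eq : forall A B C (g g' : hom B C) (f f' : hom A B),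
    hom_eq g g' -> hom_eq f f' -> hom_eq (comp g f) (comp g' f');
  comp_ident_l : forall A B (f : hom A B), hom_eq (comp (ident B) f) f;
  comp_ident_r : forall A B (f : hom A B), hom_eq (comp f (ident A)) f;
  comp_assoc : forall A B C D (h : hom C D) (g : hom B C) (f : hom A B),
    hom_eq (comp h (comp g f)) (comp (comp h g) f)
}.

Record functor (C D : category) := Functor {
  fob :> C -> D;
  fmap : forall A B : C, hom A B -> hom (fob A) (fob B);
  fmap_hom_eq : forall (A B : C) (f g : hom A B),
    hom_eq f g -> hom_eq (fmap f) (fmap g);
  fmap_ident : forall A : C, hom_eq (fmap (ident A)) (ident (fob A));
  fmap_comp : forall (A B X : C) (g : hom B X) (f : hom A B),
    hom_eq (fmap (comp g f)) (comp (fmap g) (fmap f))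
}.

Definition faithful (C D : category) (F : functor C D) : Prop :=
  forall (A B : C) (f g : hom A B), hom_eq (fmap F f) (fmap F g) -> hom_eq f g.

(* [L] is the type of letters, [J] the index type of the family of functors. *)
Inductive formula (L J : Type) : Type :=
| Letter of L
| Unit
| Tensor of formula L J & formula L J
| Endo of J & formula L J.

Arguments Letter {L J}.
Arguments Unit {L J}.
Arguments Tensor {L J}.
Arguments Endo {L J}.

Declare Scope mon_scope.
Delimit Scope mon_scope with mon.
Bind Scope mon_scope with formula.
Local Open Scope mon_scope.
Notation "A ⊗ B" := (Tensor A B) (at level 40, left associativity) : mon_scope.

Inductive term (L J : Type) : formula L J -> formula L J -> Type :=
| tId A : term A A
| tA A B C : term ((A ⊗ B) ⊗ C) (A ⊗ (B ⊗ C))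
| tAinv A B C : term (A ⊗ (B ⊗ C)) ((A ⊗ B) ⊗ C)
| tL A : term (Unit ⊗ A) A
| tLinv A : term A (Unit ⊗ A)
| tR A : term (A ⊗ Unit) A
| tRinv A : term A (A ⊗ Unit)
| tPsi i A B : term (Endo i A ⊗ Endo i B) (Endo i (A ⊗ B))
| tPsi0 i : term Unit (Endo i Unit)
| tComp A B C : term B C -> term A B -> term A C
| tTensor A B A' B' : term A B -> term A' B' -> term (A ⊗ A') (B ⊗ B')
| tEndo i A B : term A B -> term (Endo i A) (Endo i B).

Arguments tId {L J} A.
Arguments tA {L J} A B C.
Arguments tAinv {L J} A B C.
Arguments tL {L J} A.
Arguments tLinv {L J} A.
Arguments tR {L J} A.
Arguments tRinv {L J} A.
Arguments tPsi {L J} i A B.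
Arguments tPsi0 {L J} i.
Arguments tEndo {L J} i {A B} f.

Declare Scope term_scope.
Delimit Scope term_scope with term.
Bind Scope term_scope with term.
Local Open Scope term_scope.
Notation "g ∘ f" := (tComp g f) (at level 45, right associativity) : term_scope.
Notation "f ⊗ g" := (tTensor f g) (at level 40, left associativity) : term_scope.

Reserved Notation "f ≡ g" (at level 70, no associativity).

Inductive term_eq (L J : Type) : forall A B : formula L J,
    term A B -> term A B -> Prop :=
| te_refl A B (f : term A B) : f ≡ f
| te_sym A B (f g : term A B) : f ≡ g -> g ≡ f
| te_trans A B (f g h : term A B) : f ≡ g -> g ≡ h -> f ≡ h
| te_comp A B C (g g' : term B C) (f f' : term A B) :
    g ≡ g' -> f ≡ f' -> g ∘ f ≡ g' ∘ f'
| te_tensor A B A' B' (f g : term A B) (f' g' : term A' B') :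
    f ≡ g -> f' ≡ g' -> f ⊗ f' ≡ g ⊗ g'
| te_endo i A B (f g : term A B) : f ≡ g -> tEndo i f ≡ tEndo i g
| te_id_l A B (f : term A B) : tId B ∘ f ≡ f
| te_id_r A B (f : term A B) : f ∘ tId A ≡ f
| te_assoc A B C D (h : term C D) (g : term B C) (f : term A B) :
    h ∘ (g ∘ f) ≡ (h ∘ g) ∘ f
| te_tensor_id A B : tId A ⊗ tId B ≡ tId (A ⊗ B)
| te_tensor_comp A B C A' B' C' (g : term B C) (f : term A B)
    (g' : term B' C') (f' : term A' B') :
    (g ∘ f) ⊗ (g' ∘ f') ≡ (g ⊗ g') ∘ (f ⊗ f')
| te_a_nat A A' B B' C C' (f : term A A') (g : term B B') (h : term C C') :
    tA A' B' C' ∘ ((f ⊗ g) ⊗ h) ≡ (f ⊗ (g ⊗ h)) ∘ tA A B C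
| te_l_nat A A' (f : term A A') : tL A' ∘ (tId Unit ⊗ f) ≡ f ∘ tL A
| te_r_nat A A' (f : term A A') : tR A' ∘ (f ⊗ tId Unit) ≡ f ∘ tR A
| te_aK A B C : tAinv A B C ∘ tA A B C ≡ tId ((A ⊗ B) ⊗ C)
| te_aVK A B C : tA A B C ∘ tAinv A B C ≡ tId (A ⊗ (B ⊗ C))
| te_lK A : tLinv A ∘ tL A ≡ tId (Unit ⊗ A)
| te_lVK A : tL A ∘ tLinv A ≡ tId A
| te_rK A : tRinv A ∘ tR A ≡ tId (A ⊗ Unit)
| te_rVK A : tR A ∘ tRinv A ≡ tId A
| te_pentagon A B C D :
    tA A B (C ⊗ D) ∘ tA (A ⊗ B) C D
    ≡ (tId A ⊗ tA B C D) ∘ (tA A (B ⊗ C) D ∘ (tA A B C ⊗ tId D))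
| te_triangle A B : (tId A ⊗ tL B) ∘ tA A Unit B ≡ tR A ⊗ tId B
| te_endo_id i A : tEndo i (tId A) ≡ tId (Endo i A)
| te_endo_comp i A B C (g : term B C) (f : term A B) :
    tEndo i (g ∘ f) ≡ tEndo i g ∘ tEndo i f
| te_psi_nat i A A' B B' (f : term A A') (g : term B B') :
    tPsi i A' B' ∘ (tEndo i f ⊗ tEndo i g) ≡ tEndo i (f ⊗ g) ∘ tPsi i A B
| te_psi_a i A B C :
    tEndo i (tA A B C) ∘ (tPsi i (A ⊗ B) C ∘ (tPsi i A B ⊗ tId (Endo i C)))
    ≡ tPsi i A (B ⊗ C) ∘ ((tId (Endo i A) ⊗ tPsi i B C)
        ∘ tA (Endo i A) (Endo i B) (Endo i C))
| te_psi_l i A :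
    tEndo i (tL A) ∘ (tPsi i Unit A ∘ (tPsi0 i ⊗ tId (Endo i A)))
    ≡ tL (Endo i A)
| te_psi_r i A :
    tEndo i (tR A) ∘ (tPsi i A Unit ∘ (tId (Endo i A) ⊗ tPsi0 i))
    ≡ tR (Endo i A)
where "f ≡ g" := (term_eq f g).

Definition catM (L J : Type) : category :=
  @Category (formula L J) (@term L J) (@term_eq L J) (@tId L J) (@tComp L J)
    (@te_refl L J) (@te_sym L J) (@te_trans L J) (@te_comp L J)
    (@te_id_l L J) (@te_id_r L J) (@te_assoc L J).

Definition fun_id m : {ffun 'I_m -> 'I_m} := [ffun i => i].

Definition fun_comp m n p (g : {ffun 'I_n -> 'I_p}) (f : {ffun 'I_m -> 'I_n}) :
  {ffun 'I_m -> 'I_p} := [ffun i => g (f i)].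

Lemma fun_comp_id_l m n (f : {ffun 'I_m -> 'I_n}) : fun_comp (fun_id n) f = f.
Proof. by apply/ffunP=> i; rewrite !ffunE. Qed.

Lemma fun_comp_id_r m n (f : {ffun 'I_m -> 'I_n}) : fun_comp f (fun_id m) = f.
Proof. by apply/ffunP=> i; rewrite !ffunE. Qed.

Lemma fun_comp_assoc m n p q (h : {ffun 'I_p -> 'I_q})
    (g : {ffun 'I_n -> 'I_p}) (f : {ffun 'I_m -> 'I_n}) :
  fun_comp h (fun_comp g f) = fun_comp (fun_comp h g) f.
Proof. by apply/ffunP=> i; rewrite !ffunE. Qed.

Definition catFun : category.
Proof.
refine (@Category nat (fun m n => {ffun 'I_m -> 'I_n}) (fun m n => @eq _)
  fun_id fun_comp _ _ _ _ fun_comp_id_l fun_comp_id_r fun_comp_assoc).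
- by [].
- by [].
- by move=> m n f g h -> ->.
- by move=> m n p g g' f f' -> ->.
Defined.

(* The identity function, between two provably equal finite ordinals. *)
Definition fun_cast m n (e : m = n) : {ffun 'I_m -> 'I_n} :=
  [ffun i => cast_ord e i].

Definition fun_sum m n m' n' (f : {ffun 'I_m -> 'I_n})
    (f' : {ffun 'I_m' -> 'I_n'}) : {ffun 'I_(m + m') -> 'I_(n + n')} :=
  [ffun i => match split i with
             | inl j => lshift n' (f j)
             | inr j => rshift n (f' j)
             end].

Definition fun_endo m n (f : {ffun 'I_m -> 'I_n}) : {ffun 'I_m.+1 -> 'I_n.+1} :=
  [ffun i => if unlift ord0 i is Some j then lift ord0 (f j) else ord0].

(* On (1 + a) + (1 + b): the first block is fixed, the head a + 1 of the second
   block is merged with 0, and the rest of that block moves down by one. *)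
Definition psi_nat (a k : nat) : nat :=
  if k <= a then k else if k == a.+1 then 0 else k.-1.

Lemma psi_nat_subproof a b (k : 'I_(a.+1 + b.+1)) : psi_nat a k < (a + b).+1.
Proof.
rewrite /psi_nat; have := ltn_ord k.
by case: ifP => [|_]; [|case: ifP => _]; lia.
Qed.

Lemma psi_nat_le a k : k <= a -> psi_nat a k = k.
Proof. by rewrite /psi_nat => ->. Qed.

Lemma psi_nat_mid a : psi_nat a a.+1 = 0.
Proof. by rewrite /psi_nat ltnn eqxx. Qed.

Lemma psi_nat_gt a k : psi_nat a (a.+2 + k) = (a + k).+1.
Proof. by rewrite /psi_nat ifF ?ifF //=; lia. Qed.

Lemma psi_natP a k :
  k <= a /\ psi_nat a k = k \/
  k = a.+1 /\ psi_nat a k = 0 \/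
  a.+1 < k /\ psi_nat a k = k.-1.
Proof.
rewrite /psi_nat; case: (leqP k a) => [le_k|lt_k]; first by left.
case: eqVneq => ne_k; first by right; left.
by right; right; rewrite ltn_neqAle eq_sym ne_k lt_k.
Qed.

Definition fun_psi a b : {ffun 'I_(a.+1 + b.+1) -> 'I_(a + b).+1} :=
  [ffun k => Ordinal (psi_nat_subproof k)].

Definition fun_psi0 : {ffun 'I_0 -> 'I_1} := [ffun i => widen_ord (leq0n 1) i].

Fixpoint Gob (L J : Type) (A : formula L J) : nat :=
  match A with
  | Letter _ => 0
  | Unit => 0
  | Tensor A1 A2 => Gob A1 + Gob A2
  | Endo _ A1 => (Gob A1).+1
  end.

Fixpoint Gmap (L J : Type) (A B : formula L J) (f : term A B) :
    {ffun 'I_(Gob A) -> 'I_(Gob B)} :=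
  match f with
  | tId A => fun_id (Gob A)
  | tA A B C => fun_cast (esym (addnA (Gob A) (Gob B) (Gob C)))
  | tAinv A B C => fun_cast (addnA (Gob A) (Gob B) (Gob C))
  | tL A => fun_cast (add0n (Gob A))
  | tLinv A => fun_cast (esym (add0n (Gob A)))
  | tR A => fun_cast (addn0 (Gob A))
  | tRinv A => fun_cast (esym (addn0 (Gob A)))
  | tPsi _ A B => fun_psi (Gob A) (Gob B)
  | tPsi0 _ => fun_psi0
  | tComp _ _ _ g f => fun_comp (Gmap g) (Gmap f)
  | tTensor _ _ _ _ f g => fun_sum (Gmap f) (Gmap g)
  | tEndo _ _ _ f => fun_endo (Gmap f)
  end.

(* The underlying map of [Gmap f] on natural numbers, used to check that G
   respects the congruence. *)
Fixpoint Gnat (L J : Type) (A B : formula L J) (f : term A B) (k : nat) : nat :=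
  match f with
  | tPsi _ A _ => psi_nat (Gob A) k
  | tComp _ _ _ g f => Gnat g (Gnat f k)
  | tTensor A B _ _ f g =>
      if k < Gob A then Gnat f k else Gob B + Gnat g (k - Gob A)
  | tEndo _ _ _ f => if k is k'.+1 then (Gnat f k').+1 else 0
  | _ => k
  end.

Lemma val_Gmap (L J : Type) (A B : formula L J) (f : term A B)
    (k : 'I_(Gob A)) : Gmap f k = Gnat f k :> nat.
Proof.
elim: f k => {A B} /=; try by move=> *; rewrite ffunE.
- by move=> A B C g IHg f IHf k; rewrite ffunE IHg IHf.
- move=> A B A' B' f IHf g IHg k; rewrite ffunE.
  case: splitP => j ej /=; first by rewrite IHf ej.
  by rewrite IHg ej addKn.
- move=> i A B f IHf k; rewrite ffunE.
  by case: unliftP => [j|] -> //=; rewrite IHf.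
Qed.

Lemma Gnat_lt (L J : Type) (A B : formula L J) (f : term A B) k :
  k < Gob A -> Gnat f k < Gob B.
Proof. by move=> lt_k; rewrite -(val_Gmap f (Ordinal lt_k)) ltn_ord. Qed.

Lemma Gnat_eq (L J : Type) (A B : formula L J) (f g : term A B) :
  term_eq f g -> forall k, k < Gob A -> Gnat f k = Gnat g k.
Proof.
have matchS n : (if n is n'.+1 then n'.+1 else 0) = n by case: n.
elim=> {A B f g} //=.
- by move=> A B f g _ IH k lt_k; rewrite IH.
- by move=> A B f g h _ IHfg _ IHgh k lt_k; rewrite IHfg // IHgh.
- by move=> A B C g g' f f' _ IHg _ IHf k lt_k; rewrite IHf // IHg ?Gnat_lt.
- move=> A B A' B' f g f' g' _ IHf _ IHf' k lt_k.
  by case: ltnP => le_k; rewrite ?IHf ?IHf' //; lia.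
- by move=> i A B f g _ IH [|k] //= lt_k; rewrite IH.
- by move=> A B k _; case: ltnP; lia.
- move=> A B C A' B' C' g f g' f' k _.
  case: (ltnP k (Gob A)) => lt_k; first by rewrite Gnat_lt.
  by rewrite ltnNge leq_addr /= addKn.
- move=> A A' B B' C C' f g h k _; rewrite subnDA.
  by repeat case: ltnP => ? //; lia.
- by move=> A A' f k _; rewrite subn0.
- by move=> A A' f k lt_k; rewrite ifT //; lia.
- move=> A B C D k _.
  by case: (ltnP k (Gob A + Gob B + Gob C)) => ?; case: ltnP; lia.
- by move=> A B k _; rewrite addn0; case: ltnP; lia.
- by move=> _ A B C g f [].
- move=> _ A A' B B' f g [|k] //= lt_k.
  case: (ltnP k (Gob A)) => le_k.
    by rewrite ltnS le_k !psi_nat_le ?Gnat_lt //= le_k.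
  rewrite ltnS ltnNge le_k /= subSS -(subnKC le_k) addKn.
  case: (k - Gob A) => [|n]; first by rewrite !addn0 !psi_nat_mid.
  by rewrite -!addSn !addnS -!addSn !psi_nat_gt /= ltnNge leq_addr /= addKn.
- move=> _ A B C k _; rewrite matchS.
  case: (ltnP k ((Gob A).+1 + (Gob B).+1)) => lt_k;
  case: (ltnP k (Gob A).+1) => lt_k'; try lia.
  + by rewrite !psi_nat_le //; lia.
  + have := psi_natP (Gob A) k; have := psi_natP (Gob B) (k - (Gob A).+1).
    move: (psi_nat _ k) (psi_nat _ (k - _)) => x y hy hx.
    have := psi_natP (Gob A + Gob B) x; have := psi_natP (Gob A) ((Gob A).+1 + y).
    lia.
  + have := psi_natP (Gob B) (k - (Gob A).+1); move: (psi_nat _ (k - _)) => y hy.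
    have := psi_natP (Gob A) ((Gob A).+1 + y).
    have := psi_natP (Gob A + Gob B)
              ((Gob A + Gob B).+1 + (k - ((Gob A).+1 + (Gob B).+1))).
    lia.
- move=> _ A k lt_k; rewrite matchS.
  by have := psi_natP 0 (1 + (k - 0)); lia.
- move=> _ A k lt_k; rewrite addn0 in lt_k.
  by rewrite matchS lt_k psi_nat_le.
Qed.

Lemma Gmap_eq (L J : Type) (A B : formula L J) (f g : term A B) :
  term_eq f g -> Gmap f = Gmap g.
Proof.
move=> eq_fg; apply/ffunP=> k; apply/val_inj.
by rewrite /= !val_Gmap (Gnat_eq eq_fg).
Qed.

Definition functorG (L J : Type) : functor (catM L J) catFun.
Proof.
refine (@Functor (catM L J) catFun (@Gob L J) (@Gmap L J) (@Gmap_eq L J) _ _).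
- by [].
- by [].
Defined.

(* Main.v *)
From mathcomp Require Import all_boot.
From mathcomp Require Import zify.
From Stdlib Require Import Setoid Morphisms ProofIrrelevance.
Require Import Defs.
Set Implicit Arguments.
Unset Strict Implicit.
Unset Printing Implicit Defensive.

(** Up to the associativity and unit isomorphisms, an object is a list of
    primes, that is, of letters and formulae [Endo i A].  An arrow can only,
    at any depth, merge adjacent primes [Endo i A], [Endo i B] into [Endo i (A ⊗ B)], or
    create [Endo i Unit].  Hence an arrow can be read off its target:
    - an arrow into a letter or into the unit is structural, i.e. built from
      associativity and unit isomorphisms only;
    - an arrow into [B1 ⊗ B2] cuts the list of primes of its source in two and
      sends the pieces to [B1] and to [B2];
    - an arrow into [Endo i B] requires all primes of its source to be of the
      form [Endo i _]; it merges them into one [Endo i C] and then applies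
      [Endo i] to an arrow from [C] to [B].
    Arrows of this shape ([normal]) contain the identities and are closed under
    postcomposition with every arrow term ([normal_comp]), so all arrows have
    it.

    Such a presentation is unique as soon as the function on occurrences is
    known, which gives faithfulness by induction on the target.  In the tensor
    case, the left piece of the source contains as many letters as [B1] and
    precisely the occurrences of functors that are sent into [B1]; since every
    prime contains a letter or a functor, these numbers fix the cut
    ([splitting_unique]).  In the functor case the primes of the source fix the
    list that is merged, and merging hits every occurrence below [Endo i]
    ([merge_surj]), so that the function of the inner arrow is determined.
    In both cases the structural parts agree by the coherence theorem for
    monoidal categories ([structural_unique]), which is proved here by comparing
    each object with the right-nested tensor product of its primes. *)

Local Open Scope mon_scope.
Local Open Scope term_scope.

(** * Rewriting modulo the congruence *)

#[local] Instance term_eq_equiv (L J : Type) (A B : formula L J) :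
  Equivalence (@term_eq L J A B).
Proof.
by split; [exact: te_refl | exact: te_sym | exact: te_trans].
Qed.

#[local] Instance comp_proper (L J : Type) (A B C : formula L J) :
  Proper (@term_eq L J B C ==> @term_eq L J A B ==> @term_eq L J A C)
    (@tComp L J A B C).
Proof. by move=> g g' eg f f' ef; apply: te_comp. Qed.

#[local] Instance tensor_proper (L J : Type) (A B A' B' : formula L J) :
  Proper (@term_eq L J A B ==> @term_eq L J A' B' ==>
          @term_eq L J (A ⊗ A')%mon (B ⊗ B')%mon) (@tTensor L J A B A' B').
Proof. by move=> f f' ef g g' eg; apply: te_tensor. Qed.

#[local] Instance endo_proper (L J : Type) (i : J) (A B : formula L J) :
  Proper (@term_eq L J A B ==> @term_eq L J (Endo i A) (Endo i B))
    (@tEndo L J i A B).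
Proof. by move=> f f' ef; apply: te_endo. Qed.

#[local] Hint Resolve te_refl : core.

(** In a composite associated to the right two consecutive factors form a
    subterm only at the end; this form of an equation applies elsewhere. *)
Lemma comp_chain (L J : Type) (A B C : formula L J) (g : term B C)
    (f : term A B) (h : term A C) :
  g ∘ f ≡ h -> forall X (k : term X A), g ∘ (f ∘ k) ≡ h ∘ k.
Proof. by move=> e X k; rewrite te_assoc e. Qed.

Lemma comp_chain2 (L J : Type) (A B C D : formula L J) (g : term B C)
    (f : term A B) (g' : term D C) (f' : term A D) :
  g ∘ f ≡ g' ∘ f' -> forall X (k : term X A), g ∘ (f ∘ k) ≡ g' ∘ (f' ∘ k).
Proof. by move=> e X k; rewrite !te_assoc e. Qed.

Lemma tensor_comp_r (L J : Type) (A B C D : formula L J) (g : term B C)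
    (f : term A B) :
  tId D ⊗ (g ∘ f) ≡ (tId D ⊗ g) ∘ (tId D ⊗ f).
Proof. by rewrite -te_tensor_comp te_id_l. Qed.

Lemma tensor_comp_l (L J : Type) (A B C D : formula L J) (g : term B C)
    (f : term A B) :
  (g ∘ f) ⊗ tId D ≡ (g ⊗ tId D) ∘ (f ⊗ tId D).
Proof. by rewrite -te_tensor_comp te_id_l. Qed.

Lemma tensor_lr (L J : Type) (A B A' B' : formula L J) (f : term A B)
    (g : term A' B') :
  f ⊗ g ≡ (f ⊗ tId B') ∘ (tId A ⊗ g).
Proof. by rewrite -te_tensor_comp te_id_l te_id_r. Qed.

Lemma tensor_rl (L J : Type) (A B A' B' : formula L J) (f : term A B)
    (g : term A' B') :
  f ⊗ g ≡ (tId B ⊗ g) ∘ (f ⊗ tId A').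
Proof. by rewrite -te_tensor_comp te_id_l te_id_r. Qed.

Lemma iso_cancel_r (L J : Type) (A B C : formula L J) (c : term A B)
    (c' : term B A) (f g : term B C) :
  c ∘ c' ≡ tId B -> f ∘ c ≡ g ∘ c -> f ≡ g.
Proof.
by move=> cK e; rewrite -(te_id_r f) -(te_id_r g) -cK !te_assoc e.
Qed.

Lemma iso_cancel_l (L J : Type) (A B C : formula L J) (c : term B C)
    (c' : term C B) (f g : term A B) :
  c' ∘ c ≡ tId B -> c ∘ f ≡ c ∘ g -> f ≡ g.
Proof.
by move=> cK e; rewrite -(te_id_l f) -(te_id_l g) -cK -!te_assoc e.
Qed.

Lemma unit_tensor_inj (L J : Type) (A B : formula L J) (f g : term A B) :
  tId Unit ⊗ f ≡ tId Unit ⊗ g -> f ≡ g.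
Proof.
move=> e; apply: (iso_cancel_r (te_lVK A)).
by rewrite -!te_l_nat e.
Qed.

Lemma tensor_unit_inj (L J : Type) (A B : formula L J) (f g : term A B) :
  f ⊗ tId Unit ≡ g ⊗ tId Unit -> f ≡ g.
Proof.
move=> e; apply: (iso_cancel_r (te_rVK A)).
by rewrite -!te_r_nat e.
Qed.

(** Kelly's derivation of this unit law from the pentagon and the triangle:
    tensoring with the unit on the left is faithful, and after tensoring both
    sides complete the pentagon for [Unit], [Unit], [A], [B]. *)
Lemma left_unit_tensor (L J : Type) (A B : formula L J) :
  tL (A ⊗ B) ∘ tA Unit A B ≡ tL A ⊗ tId B.
Proof.
apply: unit_tensor_inj.
apply: (iso_cancel_r (te_aVK Unit (Unit ⊗ A)%mon B)).
apply: (@iso_cancel_r _ _ _ _ _ (tA Unit Unit A ⊗ tId B)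
          (tAinv Unit Unit A ⊗ tId B)).
  by rewrite -tensor_comp_l te_aVK te_tensor_id.
rewrite tensor_comp_r -!te_assoc -te_pentagon te_assoc te_triangle.
rewrite -te_tensor_id -te_a_nat -te_triangle tensor_comp_l !te_assoc.
by rewrite -te_a_nat.
Qed.

(** * Coherence for monoidal categories *)

Inductive structural (L J : Type) :
    forall A B : formula L J, term A B -> Prop :=
| st_id A : structural (tId A)
| st_a A B C : structural (tA A B C)
| st_aV A B C : structural (tAinv A B C)
| st_l A : structural (tL A)
| st_lV A : structural (tLinv A)
| st_r A : structural (tR A)
| st_rV A : structural (tRinv A)
| st_comp A B C (g : term B C) (f : term A B) :
    structural g -> structural f -> structural (g ∘ f)
| st_tensor A B A' B' (f : term A B) (g : term A' B') :
    structural f -> structural g -> structural (f ⊗ g)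
| st_eq A B (f g : term A B) : f ≡ g -> structural f -> structural g.

#[local] Hint Constructors structural : core.

Lemma structural_inv (L J : Type) (A B : formula L J) (c : term A B) :
  structural c ->
  exists c' : term B A, [/\ structural c', c' ∘ c ≡ tId A & c ∘ c' ≡ tId B].
Proof.
elim=> {A B c}.
- by move=> A; exists (tId A); split; rewrite ?te_id_l.
- by move=> A B C; exists (tAinv A B C); split; rewrite ?te_aK ?te_aVK.
- by move=> A B C; exists (tA A B C); split; rewrite ?te_aK ?te_aVK.
- by move=> A; exists (tLinv A); split; rewrite ?te_lK ?te_lVK.
- by move=> A; exists (tL A); split; rewrite ?te_lK ?te_lVK.
- by move=> A; exists (tRinv A); split; rewrite ?te_rK ?te_rVK.
- by move=> A; exists (tR A); split; rewrite ?te_rK ?te_rVK.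
- move=> A B C g f _ [g' [sg' gK gVK]] _ [f' [sf' fK fVK]].
  exists (f' ∘ g'); split; first by auto.
    by rewrite -te_assoc (comp_chain gK) te_id_l.
  by rewrite -te_assoc (comp_chain fVK) te_id_l.
- move=> A B A' B' f g _ [f' [sf' fK fVK]] _ [g' [sg' gK gVK]].
  exists (f' ⊗ g'); split; first by auto.
    by rewrite -te_tensor_comp fK gK te_tensor_id.
  by rewrite -te_tensor_comp fVK gVK te_tensor_id.
- move=> A B f g efg _ [f' [sf' fK fVK]].
  by exists f'; split; rewrite -?efg.
Qed.

(** The accumulator [s] makes the flattenings of [(A ⊗ B) ⊗ C] and
    [A ⊗ (B ⊗ C)] convertible, and likewise for the unit laws; the coherence
    proof then needs no transport at the generating isomorphisms. *)
Fixpoint flat (L J : Type) (A : formula L J) (s : seq (formula L J)) :=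
  match A with
  | Unit => s
  | Tensor B C => flat B (flat C s)
  | _ => A :: s
  end.

Fixpoint tensors (L J : Type) (s : seq (formula L J)) : formula L J :=
  if s is A :: s' then A ⊗ tensors s' else Unit.

Fixpoint flatten_arrow (L J : Type) (A : formula L J) (s : seq (formula L J)) :
    term (A ⊗ tensors s) (tensors (flat A s)) :=
  match A with
  | Letter _ | Endo _ _ => tId _
  | Unit => tL _
  | Tensor B C => flatten_arrow B (flat C s) ∘
             ((tId B ⊗ flatten_arrow C s) ∘ tA B C (tensors s))
  end.

Lemma flatten_arrow_structural (L J : Type) (A : formula L J) s :
  structural (flatten_arrow A s).
Proof. by elim: A s => /= *; auto. Qed.

Definition transport (L J : Type) (s t : seq (formula L J)) (e : s = t) :
    term (tensors s) (tensors t) :=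
  match e with erefl => tId _ end.

(** The index types are arbitrary, so equality of formulae need not be decidable
    and proof irrelevance is what makes transports independent of the equation
    that they are taken along. *)
Lemma transport_trans (L J : Type) (s t u : seq (formula L J))
    (e : s = t) (e' : t = u) (e'' : s = u) :
  transport e' ∘ transport e ≡ transport e''.
Proof.
by case: u / e' e''; case: t / e => e; rewrite (UIP_refl _ _ e) te_id_l.
Qed.

Lemma transport_structural (L J : Type) (s t : seq (formula L J)) (e : s = t) :
  structural (transport e).
Proof. by case: t / e. Qed.

Lemma flatten_arrow_transport (L J : Type) (A : formula L J) s t (e : s = t)
    (e' : flat A s = flat A t) :
  flatten_arrow A t ∘ (tId A ⊗ transport e)
  ≡ transport e' ∘ flatten_arrow A s.
Proof.
by case: t / e e' => e; rewrite (UIP_refl _ _ e) /= te_tensor_id te_id_l te_id_r.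
Qed.

Definition commutes_with_flattening (L J : Type) (A B : formula L J)
    (c : term A B) : Prop :=
  forall s, exists e : flat A s = flat B s,
    flatten_arrow B s ∘ (c ⊗ tId (tensors s)) ≡ transport e ∘ flatten_arrow A s.

Lemma commutes_inv (L J : Type) (A B : formula L J) (c : term A B)
    (c' : term B A) :
  c' ∘ c ≡ tId A -> c ∘ c' ≡ tId B ->
  commutes_with_flattening c -> commutes_with_flattening c'.
Proof.
move=> cK cVK comm s; have [e ec] := comm s; exists (esym e).
apply: (@iso_cancel_r _ _ _ _ _ (c ⊗ tId _) (c' ⊗ tId _)).
  by rewrite -tensor_comp_l cVK te_tensor_id.
rewrite -!te_assoc ec -tensor_comp_l cK te_tensor_id te_id_r te_assoc.
by rewrite (transport_trans _ _ (erefl _)) te_id_l.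
Qed.

(** The pentagon, followed by naturality of associativity. *)
Lemma commutes_assoc (L J : Type) (A B C : formula L J) :
  commutes_with_flattening (tA A B C).
Proof.
move=> s; exists (erefl _) => /=; rewrite te_id_l !tensor_comp_r -!te_assoc.
rewrite -te_pentagon; apply: te_comp => //; apply: te_comp => //.
by rewrite !te_assoc -te_a_nat te_tensor_id.
Qed.

Lemma commutes_left_unit (L J : Type) (A : formula L J) :
  commutes_with_flattening (tL A).
Proof.
move=> s; exists (erefl _) => /=; rewrite te_id_l te_assoc te_l_nat.
by rewrite -te_assoc left_unit_tensor.
Qed.

Lemma commutes_right_unit (L J : Type) (A : formula L J) :
  commutes_with_flattening (tR A).
Proof. by move=> s; exists (erefl _) => /=; rewrite te_id_l te_triangle. Qed.

Lemma structural_commutes (L J : Type) (A B : formula L J) (c : term A B) :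
  structural c -> commutes_with_flattening c.
Proof.
elim=> {A B c}.
- by move=> A s; exists (erefl _); rewrite te_tensor_id te_id_l te_id_r.
- exact: commutes_assoc.
- move=> A B C; apply: (commutes_inv (te_aK A B C) (te_aVK A B C)).
  exact: commutes_assoc.
- exact: commutes_left_unit.
- move=> A; apply: (commutes_inv (te_lK A) (te_lVK A)).
  exact: commutes_left_unit.
- exact: commutes_right_unit.
- move=> A; apply: (commutes_inv (te_rK A) (te_rVK A)).
  exact: commutes_right_unit.
- move=> A B C g f _ commg _ commf s.
  have [eg ceg] := commg s; have [ef cef] := commf s.
  exists (etrans ef eg); rewrite tensor_comp_l te_assoc ceg -te_assoc cef.
  by rewrite te_assoc (transport_trans _ _ (etrans ef eg)).
- move=> A B A' B' f g _ commf _ commg s /=.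
  have [eg ceg] := commg s; have [ef cef] := commf (flat B' s).
  exists (etrans (f_equal (flat A) eg) ef).
  rewrite -!te_assoc te_a_nat (comp_chain (te_sym (te_tensor_comp _ _ _ _))).
  rewrite te_id_l ceg tensor_lr !te_assoc cef tensor_comp_r !te_assoc.
  rewrite -(te_assoc _ _ (tId A ⊗ transport eg)).
  rewrite (flatten_arrow_transport _ (f_equal (flat A) eg)) !te_assoc.
  by rewrite (transport_trans _ _ (etrans (f_equal (flat A) eg) ef)).
- move=> A B f g efg _ commf s; have [e ce] := commf s.
  by exists e; rewrite -efg.
Qed.

(** Mac Lane's coherence theorem.  Both arrows become the same transport after
    composition with the flattening isomorphisms, which can be cancelled. *)
Lemma structural_unique (L J : Type) (A B : formula L J) (c d : term A B) :
  structural c -> structural d -> c ≡ d.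
Proof.
move=> sc sd; apply: tensor_unit_inj.
have [ec cec] := structural_commutes sc [::].
have [ed ced] := structural_commutes sd [::].
have [n' [_ nK _]] := structural_inv (flatten_arrow_structural B [::]).
apply: (iso_cancel_l nK); rewrite cec ced.
by rewrite (proof_irrelevance _ ec ed).
Qed.

Lemma structural_flat (L J : Type) (A B : formula L J) (c : term A B) s :
  structural c -> flat A s = flat B s.
Proof. by move=> /structural_commutes/(_ s) []. Qed.

Lemma structural_exists (L J : Type) (A B : formula L J) :
  flat A [::] = flat B [::] -> exists c : term A B, structural c.
Proof.
move=> e.
have [n' [sn' _ _]] := structural_inv (flatten_arrow_structural B [::]).
exists (tR B ∘ (n' ∘ (transport e ∘ (flatten_arrow A [::] ∘ tRinv A)))).
have := flatten_arrow_structural A [::]; have := transport_structural e.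
by auto 10.
Qed.

(** * Merging a list of functor applications *)

Fixpoint merge (L J : Type) (i : J) (s : seq (formula L J)) :
    term (tensors (map (Endo i) s)) (Endo i (tensors s)) :=
  match s with
  | [::] => tPsi0 i
  | A :: s' => tPsi i A (tensors s') ∘ (tId (Endo i A) ⊗ merge i s')
  end.

(** The isomorphisms that concatenate two flattened objects: [join] for the
    arguments of [Endo i], [join_map] for the applications themselves. *)
Fixpoint join (L J : Type) (s t : seq (formula L J)) :
    term (tensors s ⊗ tensors t) (tensors (s ++ t)) :=
  match s with
  | [::] => tL _
  | A :: s' => (tId A ⊗ join s' t) ∘ tA A (tensors s') (tensors t)
  end.

Fixpoint join_map (L J : Type) (i : J) (s t : seq (formula L J)) :
    term (tensors (map (Endo i) s) ⊗ tensors (map (Endo i) t))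
         (tensors (map (Endo i) (s ++ t))) :=
  match s with
  | [::] => tL _
  | A :: s' => (tId (Endo i A) ⊗ join_map i s' t) ∘
               tA (Endo i A) (tensors (map (Endo i) s')) _
  end.

Lemma join_structural (L J : Type) (s t : seq (formula L J)) :
  structural (join s t).
Proof. by elim: s => /= *; auto. Qed.

Lemma join_map_structural (L J : Type) i (s t : seq (formula L J)) :
  structural (join_map i s t).
Proof. by elim: s => /= *; auto. Qed.

(** Merging two lists separately and then the two results amounts to merging the
    concatenated list.  The empty list is the left unit law of [psi]; the
    inductive step is its compatibility with associativity. *)
Lemma merge_join (L J : Type) (i : J) (s t : seq (formula L J)) :
  tEndo i (join s t) ∘ (tPsi i (tensors s) (tensors t) ∘ (merge i s ⊗ merge i t))
  ≡ merge i (s ++ t) ∘ join_map i s t.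
Proof.
elim: s => [|A s IH] /=.
  by rewrite tensor_lr !te_assoc -(te_assoc (tEndo i _)) te_psi_l te_l_nat.
rewrite -{1}(te_id_l (merge i t)) te_tensor_comp te_endo_comp -!te_assoc.
(* the associativity law of psi, applied in front of a further arrow *)
have assocE X (k : term X _) :
    tEndo i (tA A (tensors s) (tensors t)) ∘
      (tPsi i _ _ ∘ ((tPsi i A (tensors s) ⊗ tId _) ∘ k))
    ≡ tPsi i A _ ∘ ((tId _ ⊗ tPsi i _ _) ∘ (tA _ _ _ ∘ k)).
  have := te_comp (te_psi_a i A (tensors s) (tensors t)) (te_refl k).
  by rewrite -!te_assoc.
rewrite assocE te_a_nat te_assoc -te_psi_nat te_endo_id -!te_assoc.
apply: te_comp => //; rewrite !te_assoc; apply: te_comp => //.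
by rewrite -!te_assoc -!tensor_comp_r IH.
Qed.

(** * Normal arrows *)

(** The pieces of the source are arbitrary formulae, related to it by a
    structural arrow, rather than sublists of its primes: precomposition with
    structural arrows then only affects that arrow. *)
Fixpoint normal (L J : Type) (B : formula L J) :
    forall A : formula L J, term A B -> Prop :=
  match B return forall A : formula L J, term A B -> Prop with
  | Letter _ | Unit => fun A f => structural f
  | Tensor B1 B2 => fun A f =>
      exists A1 A2 (c : term A (A1 ⊗ A2)) (f1 : term A1 B1) (f2 : term A2 B2),
        [/\ structural c, normal f1, normal f2 & f ≡ (f1 ⊗ f2) ∘ c]
  | Endo i B1 => fun A f =>
      exists s (c : term A (tensors (map (Endo i) s))) (g : term (tensors s) B1),
        [/\ structural c, normal g & f ≡ tEndo i g ∘ (merge i s ∘ c)]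
  end.

Lemma normal_eq (L J : Type) (A B : formula L J) (f g : term A B) :
  f ≡ g -> normal f -> normal g.
Proof.
case: B f g => /=; try by eauto.
- move=> B1 B2 f g e [A1 [A2 [c [f1 [f2 [sc n1 n2 ef]]]]]].
  by exists A1, A2, c, f1, f2; split=> //; rewrite -e.
- move=> i B f g e [s [c [h [sc nh ef]]]].
  by exists s, c, h; split=> //; rewrite -e.
Qed.

Lemma normal_structural (L J : Type) (A A' B : formula L J) (c : term A' A)
    (f : term A B) :
  structural c -> normal f -> normal (f ∘ c).
Proof.
move=> sc; case: B f => /=; try by auto.
- move=> B1 B2 f [A1 [A2 [d [f1 [f2 [sd n1 n2 ef]]]]]].
  by exists A1, A2, (d ∘ c), f1, f2; split; auto; rewrite ef te_assoc.
- move=> i B f [s [d [h [sd nh ef]]]].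
  by exists s, (d ∘ c), h; split; auto; rewrite ef -!te_assoc.
Qed.

(** For [Endo i A] the identity merges the one-element list of [A],
    whose tensor product is [A ⊗ Unit]; this is the right unit law of [psi]. *)
Lemma normal_id (L J : Type) (A : formula L J) : normal (tId A).
Proof.
elim: A => /=; auto.
- move=> A nA B nB.
  by exists A, B, (tId _), (tId _), (tId _); split=> //; rewrite te_id_r te_tensor_id.
- move=> i A nA; exists [:: A], (tRinv _), (tR A); split=> //.
    apply: (@normal_eq _ _ _ _ (tId A ∘ tR A)); first by rewrite te_id_l.
    exact: normal_structural.
  rewrite /= !te_assoc -(te_assoc _ (tPsi i _ _)) te_psi_r.
  by rewrite te_rVK.
Qed.

Lemma normal_tensor (L J : Type) (A B A' B' : formula L J) (f : term A B)
    (g : term A' B') :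
  normal f -> normal g -> normal (f ⊗ g).
Proof.
by move=> nf ng; exists A, A', (tId _), f, g; split; rewrite ?te_id_r.
Qed.

(** If [h] merges [s1] on the left and [s2] on the right, then [tPsi] after [h]
    merges [s1 ++ s2], by [merge_join]. *)
Lemma normal_psi (L J : Type) (i : J) (A B C : formula L J)
    (h : term A (Endo i B ⊗ Endo i C)) :
  normal h -> normal (tPsi i B C ∘ h).
Proof.
move=> [A1 [A2 [c [h1 [h2 [sc [s1 [c1 [f1 [sc1 n1 e1]]]]]]]]]].
move=> [s2 [c2 [f2 [sc2 n2 e2]]]] e.
have [j' [sj' jK _]] := structural_inv (join_structural s1 s2).
exists (s1 ++ s2), (join_map i s1 s2 ∘ ((c1 ⊗ c2) ∘ c)), ((f1 ⊗ f2) ∘ j').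
split.
- have := join_map_structural i s1 s2; auto.
- exact: normal_structural (normal_tensor n1 n2).
- rewrite e e1 e2 (te_assoc (merge _ _)) -merge_join te_endo_comp.
  rewrite !te_tensor_comp -!te_assoc (comp_chain2 (te_psi_nat _ _ _)).
  apply: te_comp => //; rewrite (te_assoc (tEndo i j')) -te_endo_comp jK.
  by rewrite te_endo_id te_id_l.
Qed.

(** Induction on [g] rather than on [h]: a composite is then absorbed one factor
    at a time, and each generator only rearranges the data that witness the
    normality of [h]. *)
Lemma normal_comp (L J : Type) (A B C : formula L J) (g : term B C)
    (h : term A B) :
  normal h -> normal (g ∘ h).
Proof.
move=> nh; elim: g A h nh => {B C}.
- by move=> B A h; apply: normal_eq; rewrite te_id_l.
- move=> B C D A h [A1 [A2 [c [h1 [h2 [sc]]]]]].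
  move=> [A3 [A4 [c1 [h3 [h4 [sc1 n3 n4 e1]]]]]] n2 e.
  exists A3, (A4 ⊗ A2)%mon, (tA _ _ _ ∘ ((c1 ⊗ tId _) ∘ c)), h3, (h4 ⊗ h2).
  split=> //; first by auto.
    exact: normal_tensor.
  rewrite e e1 !te_assoc -te_a_nat -!te_assoc; apply: te_comp => //.
  by rewrite te_assoc -te_tensor_comp te_id_r.
- move=> B C D A h [A1 [A2 [c [h1 [h2 [sc n1]]]]]].
  move=> [A3 [A4 [c1 [h3 [h4 [sc1 n3 n4 e1]]]]]] e.
  exists (A1 ⊗ A3)%mon, A4, (tAinv _ _ _ ∘ ((tId _ ⊗ c1) ∘ c)), (h1 ⊗ h3), h4.
  split=> //; first by auto.
    exact: normal_tensor.
  apply: (iso_cancel_l (te_aK _ _ _)).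
  rewrite e e1 (te_assoc (tA _ _ _)) te_aVK te_id_l te_assoc te_a_nat.
  rewrite -te_assoc (comp_chain (te_aVK _ _ _)) te_id_l te_assoc.
  by rewrite -te_tensor_comp te_id_r.
- move=> B A h [A1 [A2 [c [h1 [h2 [sc s1 n2 e]]]]]].
  apply: (@normal_eq _ _ _ _ (h2 ∘ (tL A2 ∘ ((h1 ⊗ tId _) ∘ c)))).
    by rewrite e (tensor_rl h1 h2) -te_assoc (comp_chain2 (te_l_nat h2)).
  by apply: normal_structural => //; simpl in s1; auto.
- move=> B A h nh.
  exists Unit, A, (tLinv A), (tId _), h; split=> //=.
  apply: (iso_cancel_l (te_lK _)).
  rewrite te_assoc te_lVK te_id_l te_assoc te_l_nat -te_assoc te_lVK.
  by rewrite te_id_r.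
- move=> B A h [A1 [A2 [c [h1 [h2 [sc n1 s2 e]]]]]].
  apply: (@normal_eq _ _ _ _ (h1 ∘ (tR A1 ∘ ((tId _ ⊗ h2) ∘ c)))).
    by rewrite e (tensor_lr h1 h2) -te_assoc (comp_chain2 (te_r_nat h1)).
  by apply: normal_structural => //; simpl in s2; auto.
- move=> B A h nh.
  exists A, Unit, (tRinv A), h, (tId _); split=> //=.
  apply: (iso_cancel_l (te_rK _)).
  rewrite te_assoc te_rVK te_id_l te_assoc te_r_nat -te_assoc te_rVK.
  by rewrite te_id_r.
- by move=> i B C A h; apply: normal_psi.
- move=> i A h /= sh; exists [::], h, (tId _); split=> //=.
  by rewrite te_endo_id te_id_l.
- move=> B C D g IHg f IHf A h nh.
  by apply: (@normal_eq _ _ _ _ (g ∘ (f ∘ h))); auto; rewrite te_assoc.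
- move=> B C B' C' f IHf g IHg A h [A1 [A2 [c [h1 [h2 [sc n1 n2 e]]]]]].
  exists A1, A2, c, (f ∘ h1), (g ∘ h2); split; auto.
  by rewrite e te_assoc te_tensor_comp.
- move=> i B C f IHf A h [s [c [g [sc ng e]]]].
  exists s, c, (f ∘ g); split; auto.
  by rewrite e te_endo_comp te_assoc.
Qed.

Lemma all_normal (L J : Type) (A B : formula L J) (f : term A B) : normal f.
Proof.
apply: (@normal_eq _ _ _ _ (f ∘ tId A)); first by rewrite te_id_r.
exact/normal_comp/normal_id.
Qed.

(** * Reading the normal form off the function on occurrences *)

Lemma structural_Gnat (L J : Type) (A B : formula L J) (c : term A B) :
  structural c ->
  Gob A = Gob B /\ forall k, k < Gob A -> Gnat c k = k.
Proof.
elim=> {A B c} //=.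
- by move=> *; rewrite addnA.
- by move=> *; rewrite addnA.
- by move=> *; rewrite addn0.
- by move=> *; rewrite addn0.
- by move=> A B C g f _ [eg Gg] _ [ef Gf]; split=> [|k lt_k];
    rewrite ?ef // Gf // Gg // -ef.
- move=> A B A' B' f g _ [ef Gf] _ [eg Gg]; split=> [|k lt_k].
    by rewrite ef eg.
  by case: ltnP => le_k; rewrite ?Gf ?Gg //; lia.
- move=> A B f g e _ [eG Gf]; split=> // k lt_k.
  by rewrite -(Gnat_eq e) // Gf.
Qed.

(** Letters and occurrences of functors together, so that every prime has
    positive weight. *)
Fixpoint weight (L J : Type) (A : formula L J) : nat :=
  match A with
  | Letter _ => 1
  | Unit => 0
  | Tensor B C => weight B + weight C
  | Endo _ B => (weight B).+1
  end.

Fixpoint letters (L J : Type) (A : formula L J) : nat :=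
  match A with
  | Letter _ => 1
  | Unit => 0
  | Tensor B C => letters B + letters C
  | Endo _ B => letters B
  end.

Lemma weightE (L J : Type) (A : formula L J) : weight A = letters A + Gob A.
Proof. by elim: A => //= *; lia. Qed.

Lemma term_letters (L J : Type) (A B : formula L J) (f : term A B) :
  letters A = letters B.
Proof. by elim: f => //= *; lia. Qed.

Lemma flat_cat (L J : Type) (A : formula L J) s :
  flat A s = flat A [::] ++ s.
Proof.
elim: A s => //= A IHA B IHB s.
by rewrite IHA IHB (IHA (flat B _)) catA.
Qed.

Lemma weight_flat (L J : Type) (A : formula L J) :
  weight A = sumn (map (@weight L J) (flat A [::])).
Proof.
elim: A => //=.
- by move=> A -> B ->; rewrite (flat_cat A (flat B _)) map_cat sumn_cat.
- by move=> i A _; rewrite addn0.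
Qed.

Lemma flat_weight_gt0 (L J : Type) (A : formula L J) :
  all (fun X => 0 < weight X) (flat A [::]).
Proof. by elim: A => //= A IHA B IHB; rewrite flat_cat all_cat IHA. Qed.

Lemma cat_inj_weight (T : Type) (w : T -> nat) (s1 s2 t1 t2 : seq T) :
  all (fun x => 0 < w x) s1 -> all (fun x => 0 < w x) t1 ->
  sumn (map w s1) = sumn (map w t1) -> s1 ++ s2 = t1 ++ t2 ->
  s1 = t1 /\ s2 = t2.
Proof.
elim: s1 t1 => [|x s1 IH] [|y t1] //=; try by lia.
move=> /andP[_ ps] /andP[_ pt] e [exy est]; subst y.
by have [|-> ->] := IH t1 ps pt _ est; first by lia.
Qed.

Lemma flat_tensors_endo (L J : Type) (i : J) (s : seq (formula L J)) :
  flat (tensors (map (Endo i) s)) [::] = map (Endo i) s.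
Proof. by elim: s => //= A s ->. Qed.

Lemma map_endo_inj (L J : Type) (i : J) : injective (map (@Endo L J i)).
Proof. by apply: inj_map => A B []. Qed.

Lemma merge_surj (L J : Type) (i : J) (s : seq (formula L J)) m :
  m < Gob (tensors s) ->
  exists2 k, k < Gob (tensors (map (Endo i) s)) & Gnat (merge i s) k = m.+1.
Proof.
elim: s m => //= A s IH m lt_m.
case: (ltnP m (Gob A)) => le_m.
  exists m.+1; first by lia.
  by rewrite ltnS le_m psi_nat_le.
have [|k lt_k ek] := IH (m - Gob A); first by lia.
exists ((Gob A).+1 + k); first by lia.
rewrite ltnNge leq_addr /= addKn ek -addSnnS psi_nat_gt; lia.
Qed.

Lemma Gnat_comp (L J : Type) (A B C : formula L J) (g : term B C)
    (f : term A B) k :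
  Gnat (g ∘ f) k = Gnat g (Gnat f k).
Proof. by []. Qed.

Lemma Gnat_tensor_l (L J : Type) (A B A' B' : formula L J) (f : term A B)
    (g : term A' B') k :
  k < Gob A -> Gnat (f ⊗ g) k = Gnat f k.
Proof. by move=> /= ->. Qed.

Lemma Gnat_tensor_r (L J : Type) (A B A' B' : formula L J) (f : term A B)
    (g : term A' B') k :
  Gnat (f ⊗ g) (Gob A + k) = Gob B + Gnat g k.
Proof. by rewrite /= ltnNge leq_addr /= addKn. Qed.

(** If the cuts differed, the first functor in excess on one side would be sent
    into [B1] by one of the arrows and into [B2] by the other; so the left
    pieces contain equally many functors.  They contain equally many letters,
    namely those of [B1], hence they have equal weights. *)
Lemma splitting_unique (L J : Type) (A1 A2 A1' A2' B1 B2 : formula L J)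
    (f1 : term A1 B1) (f2 : term A2 B2) (g1 : term A1' B1) (g2 : term A2' B2) :
  flat (A1 ⊗ A2) [::] = flat (A1' ⊗ A2') [::] ->
  (forall k, k < Gob (A1 ⊗ A2) -> Gnat (f1 ⊗ f2) k = Gnat (g1 ⊗ g2) k) ->
  flat A1 [::] = flat A1' [::] /\ flat A2 [::] = flat A2' [::].
Proof.
move=> efl eG.
have [c sc] := structural_exists efl; have [eGob _] := structural_Gnat sc.
have {c sc}efl : flat A1 [::] ++ flat A2 [::] = flat A1' [::] ++ flat A2' [::].
  by rewrite -!(flat_cat _ (flat _ _)).
apply: (cat_inj_weight (w := @weight L J) _ _ _ efl);
  rewrite ?flat_weight_gt0 // -!weight_flat !weightE.
rewrite (term_letters f1) (term_letters g1); congr (_ + _).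
rewrite /= in eGob.
case: (ltngtP (Gob A1) (Gob A1')) => // lt_A.
- have := eG (Gob A1 + 0); rewrite Gnat_tensor_r Gnat_tensor_l /=; last by lia.
  have := @Gnat_lt _ _ _ _ g1 (Gob A1); rewrite addn0; lia.
- have := eG (Gob A1' + 0); rewrite Gnat_tensor_r Gnat_tensor_l /=; last by lia.
  have := @Gnat_lt _ _ _ _ f1 (Gob A1'); rewrite addn0; lia.
Qed.

(** Induction on the target: both arrows are put in normal form, their
    structural parts are identified, and the inner arrows have equal functions. *)
Lemma Gnat_faithful (L J : Type) (A B : formula L J) (f g : term A B) :
  (forall k, k < Gob A -> Gnat f k = Gnat g k) -> f ≡ g.
Proof.
have := all_normal g; have := all_normal f.
elim: B A f g => [p||B1 IH1 B2 IH2|i B IH] A f g /=.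
- by move=> sf sg _; apply: structural_unique.
- by move=> sf sg _; apply: structural_unique.
- move=> [A1 [A2 [c [f1 [f2 [sc n1 n2 ef]]]]]].
  move=> [A1' [A2' [d [g1 [g2 [sd n1' n2' eg]]]]]] eG.
  have efl : flat (A1 ⊗ A2) [::] = flat (A1' ⊗ A2') [::].
    by rewrite -(structural_flat _ sc) (structural_flat _ sd).
  have [ec Gc] := structural_Gnat sc; have [ed Gd] := structural_Gnat sd.
  have {}eG k : k < Gob (A1 ⊗ A2) -> Gnat (f1 ⊗ f2) k = Gnat (g1 ⊗ g2) k.
    rewrite -ec => lt_k.
    have := eG k lt_k; rewrite (Gnat_eq ef) // (Gnat_eq eg) //.
    by rewrite !Gnat_comp Gc // Gd.
  (* the pieces may still differ by structural arrows e1 and e2 *)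
  have [/structural_exists[e1 s1] /structural_exists[e2 s2]] :=
    splitting_unique efl eG.
  have [eG1 Ge1] := structural_Gnat s1; have [eG2 Ge2] := structural_Gnat s2.
  have ede : d ≡ (e1 ⊗ e2) ∘ c by apply: structural_unique; auto.
  rewrite ef eg ede te_assoc -te_tensor_comp; apply: te_comp => //.
  apply: te_tensor.
    apply: IH1 => //; first exact: normal_structural.
    move=> k lt_k; have := eG k; rewrite !Gnat_tensor_l -?eG1 //= Ge1 //.
    by apply; lia.
  apply: IH2 => //; first exact: normal_structural.
  move=> k lt_k; have := eG (Gob A1 + k).
  rewrite Gnat_tensor_r eG1 Gnat_tensor_r /= Ge2 // => /(_ _)/addnI; apply.
  by lia.
- move=> [s [c [f' [sc nf ef]]]] [t [d [g' [sd ng eg]]]] eG.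
  have est : s = t.
    apply: (@map_endo_inj L J i).
    have := structural_flat [::] sc; rewrite (structural_flat [::] sd).
    by rewrite !flat_tensors_endo.
  subst t; have ecd := structural_unique sc sd.
  rewrite ef eg ecd; apply: te_comp => //; apply: te_endo; apply: IH => // m lt_m.
  have [k lt_k ek] := merge_surj i lt_m.
  have [ec Gc] := structural_Gnat sc; have [ed Gd] := structural_Gnat sd.
  rewrite -ec in lt_k; have := eG k lt_k.
  rewrite (Gnat_eq ef) // (Gnat_eq eg) //= Gc // Gd // ek.
  by case.
Qed.

Theorem mainTheorem1 (L J : Type) : faithful (functorG L J).
Proof.
move=> A B f g /= eG; apply: Gnat_faithful => k lt_k.
by rewrite -!(val_Gmap _ (Ordinal lt_k)) eG.
Qed.
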